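(* Let $M\cong\mathbb{Z}^n$ be a lattice with $n\ge 3$, and let $P\subseteq M_{\mathbb R}=M\otimes_{\mathbb Z}\mathbb R$ be an $n$-dimensional reflexive polytope. For $k\ge 0$ let $\Lambda_k\subseteq M$ denote the sublattice generated by all lattice points of $M$ lying in the $k$-skeleton of $P$ (the union of all $k$-dimensional faces of $P$). Then $\Lambda_{n-2}=\Lambda_{n-1}$; that is, the lattice generated by all lattice points in the boundary of $P$ is already generated by the lattice points lying in faces of $P$ of codimension two.
   Context: Let $N=\mathrm{Hom}_{\mathbb Z}(M,\mathbb Z)$ be the dual lattice, with pairing $\langle\cdot,\cdot\rangle$ between $N$ and $M$ (extended to $N_{\mathbb R}\times M_{\mathbb R}$). A reflexive polytope is an $n$-dimensional lattice polytope $P\subseteq M_{\mathbb R}$ (i.e., with vertices in $M$) that contains the origin in its interior and whose dual polytope $P^*=\{u\in N_{\mathbb R}:\langle u,m\rangle\ge -1\ \forall m\in P\}$ is a lattice polytope with respect to $N$. Equivalently, every facet $F$ of $P$ is of the form $F=\{m\in P:\langle \eta_F,m\rangle=-1\}$ for a unique $\eta_F\in N$ with $\langle\eta_F,m\rangle\ge -1$ for all $m\in P$. *)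

(* Defs.v *)
From HB Require Import structures.
From mathcomp Require Import all_boot all_order all_algebra.
From mathcomp Require Import reals.
Set Implicit Arguments. Unset Strict Implicit. Unset Printing Implicit Defensive.
Import Order.TTheory GRing.Theory Num.Theory.
Local Open Scope ring_scope.

(* pairing <u, x> = sum_i u_i x_i (N identified with Z^n via the dual basis) *)
Definition pairing (R : pzRingType) (n : nat) (u x : 'rV[R]_n) : R :=
  \sum_(i < n) u 0 i * x 0 i.

Definition to_real (R : realType) (n : nat) (m : 'rV[int]_n) : 'rV[R]_n :=
  map_mx (fun z : int => z%:~R) m.

Definition conv (R : realType) (n : nat) (V : seq 'rV[int]_n) (x : 'rV[R]_n) : Prop :=
  exists lam : 'I_(size V) -> R,
    [/\ forall i, 0 <= lam i, \sum_i lam i = 1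
      & x = \sum_i lam i *: @to_real R n (nth 0 V i)].

Definition origin_interior (R : realType) (n : nat) (P : 'rV[R]_n -> Prop) : Prop :=
  exists2 eps : R, 0 < eps &
    forall x : 'rV[R]_n, (forall j, `|x 0 j| < eps) -> P x.

Definition dual (R : realType) (n : nat) (P : 'rV[R]_n -> Prop) (u : 'rV[R]_n) : Prop :=
  forall m, P m -> -1 <= pairing u m.

(* P = conv V is reflexive: origin in interior (hence n-dimensional) and
   P^* is a lattice polytope w.r.t. N = Z^n *)
Definition reflexive_polytope (R : realType) (n : nat) (V : seq 'rV[int]_n) : Prop :=
  origin_interior (@conv R n V) /\
  exists W : seq 'rV[int]_n, forall u, dual (@conv R n V) u <-> @conv R n W u.

(* F is a face of P: intersection with a supporting hyperplane (P itself allowed) *)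
Definition is_face (R : realType) (n : nat) (P F : 'rV[R]_n -> Prop) : Prop :=
  exists (u : 'rV[R]_n) (c : R),
    (forall x, P x -> c <= pairing u x) /\
    (forall x, F x <-> P x /\ pairing u x = c).

(* affine dimension of F equals k: F contains k+1 affinely independent points,
   and no k+2 *)
Definition diff_mx (R : realType) (n m : nat) (X : 'M[R]_(m, n)) (x0 : 'rV[R]_n)
  : 'M[R]_(m, n) := \matrix_(i, j) (X i j - x0 0 j).

Definition affdim (R : realType) (n : nat) (F : 'rV[R]_n -> Prop) (k : nat) : Prop :=
  (exists (m : nat) (X : 'M[R]_(m, n)) (x0 : 'rV[R]_n),
      [/\ F x0, forall i, F (row i X) & \rank (diff_mx X x0) = k]) /\
  (forall (m : nat) (X : 'M[R]_(m, n)) (x0 : 'rV[R]_n),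
      F x0 -> (forall i, F (row i X)) -> (\rank (diff_mx X x0) <= k)%N).

Definition skeleton (R : realType) (n : nat) (P : 'rV[R]_n -> Prop) (k : nat)
  (x : 'rV[R]_n) : Prop :=
  exists F, [/\ is_face P F, affdim F k & F x].

Definition lattice_gen (n : nat) (S : 'rV[int]_n -> Prop) (v : 'rV[int]_n) : Prop :=
  exists s : seq 'rV[int]_n,
    (forall w, w \in s -> S w) /\
    exists c : 'I_(size s) -> int, v = \sum_i c i *: nth 0 s i.

Definition Lambda (R : realType) (n : nat) (P : 'rV[R]_n -> Prop) (k : nat)
  (v : 'rV[int]_n) : Prop :=
  lattice_gen (fun m => skeleton P k (@to_real R n m)) v.

(* Main.v *)
(* A lattice point m of the polytope that is not in Lambda_(n-2) =: L is tight for
   exactly one facet form F.  Hence q + m is in P for every lattice point q of P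
   off the facet F, and repeating this walks from q to level 0 or -1 of F.
   Starting from a vertex, one obtains points a and x outside L, interior to
   facets F and G, with F(x) = G(a) = 0.  No nonzero lattice point z of P has
   F(z) = G(z) = 0: if z lies on the facet H, walking along z from a, x and a + x
   meets L with coefficients of z that force z into L.  Consequently a lattice
   point q of P with F(q), G(q) >= 0 equals -(F(q) a + G(q) x).  Such a nonzero q
   exists, so -a (say) is in P, on a facet H.  A second lattice point of the ridge
   of F and G (this uses n >= 3) moves x, so that -a is the only such q; by
   symmetry a is the only one for the pair H, G.  A vertex w with G(w) > 0 then
   lies on F and H, and w + G(w) x = a for two different x, a contradiction.

   The polytope is recovered from its facet forms by the bipolar theorem (Farkas'
   lemma), and a point tight for two forms lies in a face of dimension n-2
   because the cone of forms tight at it has a two-dimensional face. *)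
Require Import Defs.
From HB Require Import structures.
From mathcomp Require Import all_boot all_order all_algebra.
From mathcomp Require Import reals.
From mathcomp Require Import zify ring lra.
From Stdlib Require Import Classical.
Set Implicit Arguments. Unset Strict Implicit. Unset Printing Implicit Defensive.
Import Order.TTheory GRing.Theory Num.Theory.
Local Open Scope ring_scope.

(** * Bilinearity of the pairing *)

Section Pairing.
Variables (A : comNzRingType) (n : nat).
Implicit Types u x : 'rV[A]_n.

Lemma pairingC u x : pairing u x = pairing x u.
Proof. by apply: eq_bigr => i _; rewrite mulrC. Qed.

Lemma pairingDr u x y : pairing u (x + y) = pairing u x + pairing u y.
Proof. by rewrite -big_split; apply: eq_bigr => i _; rewrite mxE mulrDr. Qed.

Lemma pairingZr u k x : pairing u (k *: x) = k * pairing u x.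
Proof. by rewrite mulr_sumr; apply: eq_bigr => i _; rewrite mxE mulrCA. Qed.

Lemma pairingNr u x : pairing u (- x) = - pairing u x.
Proof. by rewrite -scaleN1r pairingZr mulN1r. Qed.

Lemma pairing0r u : pairing u 0 = 0.
Proof. by rewrite -[0](scale0r 0) pairingZr mul0r. Qed.

Lemma pairingDl u u' x : pairing (u + u') x = pairing u x + pairing u' x.
Proof. by rewrite ![pairing _ x]pairingC pairingDr. Qed.

Lemma pairingZl k u x : pairing (k *: u) x = k * pairing u x.
Proof. by rewrite ![pairing _ x]pairingC pairingZr. Qed.

Lemma pairingNl u x : pairing (- u) x = - pairing u x.
Proof. by rewrite ![pairing _ x]pairingC pairingNr. Qed.

Lemma pairing0l x : pairing 0 x = 0.
Proof. by rewrite pairingC pairing0r. Qed.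

End Pairing.

Lemma scale_row_eq0 (A : idomainType) n (k : A) (x : 'rV[A]_n) :
  (k *: x == 0) = (k == 0) || (x == 0).
Proof.
apply/eqP/orP => [kx|[]/eqP->]; rewrite ?scale0r ?scaler0 //.
case: (eqVneq k 0) => [|k0]; first by left.
right; apply/eqP/rowP => j; have /rowP/(_ j)/eqP := kx.
by rewrite !mxE mulf_eq0 (negPf k0) => /eqP.
Qed.

(** * Walking between lattice points *)

Section LatticePoints.
Variables (I : eqType) (n : nat) (f : I -> 'rV[int]_n -> int).
Variables (W : seq I) (L : 'rV[int]_n -> Prop).

Let inP (m : 'rV[int]_n) : Prop := forall e, e \in W -> -1 <= f e m.

Hypothesis fD : forall e x y, f e (x + y) = f e x + f e y.
Hypothesis fZ : forall e k x, f e (k *: x) = k * f e x.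
Hypothesis L0 : L 0.
Hypothesis LD : forall v w, L v -> L w -> L (v + w).
Hypothesis LN : forall v, L v -> L (- v).
(** Convex geometry enters the walking argument only through these last four hypotheses. The case
    [F = G] of [positive_point] gives a point of [L] at positive height over one facet; the strict
    bound on [H] in [ridge_point] permits a step from [r'] along a vector tight for [H] alone. *)
Hypothesis tight_exists :
  forall m, inP m -> m != 0 -> exists2 e, e \in W & f e m = -1.
Hypothesis two_tight : forall m F G, inP m -> F \in W -> G \in W -> F != G ->
  f F m = -1 -> f G m = -1 -> L m.
Hypothesis positive_point : forall F G r, F \in W -> G \in W ->
  f F r = -1 -> f G r = -1 ->
  exists v, [/\ inP v, L v & 0 < f F v + f G v].
Hypothesis ridge_point : forall F G H r, F \in W -> G \in W -> H \in W ->
  inP r -> f F r = -1 -> f G r = -1 -> -1 < f H r ->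
  (forall e, e \in W -> f e r = -1 -> e = F \/ e = G) ->
  exists r', [/\ inP r', r' != r, f F r' = -1, f G r' = -1
    & -1 < f H r'].

Lemma f0 e : f e 0 = 0.
Proof. by rewrite -[0](scale0r 0) fZ mul0r. Qed.

Lemma fN e x : f e (- x) = - f e x.
Proof. by rewrite -scaleN1r fZ mulN1r. Qed.

Let fE := (fD, fN, fZ, f0).

Lemma L_sub v w : L (v + w) -> L v -> L w.
Proof. by move=> /LD Lvw /LN /Lvw; rewrite addrC addKr. Qed.

Lemma notL_neq0 m : ~ L m -> m != 0.
Proof. by move=> Lm; apply/eqP => m0; apply: Lm; rewrite m0. Qed.

Lemma notL_unique m F G : inP m -> ~ L m -> F \in W -> G \in W ->
  f F m = -1 -> f G m = -1 -> F = G.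
Proof.
move=> Pm Lm FW GW Fm Gm; apply/eqP/negPn/negP => FG.
exact: Lm (two_tight Pm FW GW FG Fm Gm).
Qed.

Lemma notL_ge0 m F G : inP m -> ~ L m -> F \in W -> G \in W ->
  f F m = -1 -> F != G -> 0 <= f G m.
Proof.
move=> Pm Lm FW GW Fm FG.
have := Pm _ GW; case: (eqVneq (f G m) (-1)) => [Gm|]; last by lia.
by rewrite (notL_unique Pm Lm FW GW Fm Gm) eqxx in FG.
Qed.

(** Integrality: a form that is not tight is at least 0, so a sum falls below -1 only if both
    summands are tight. *)
Lemma inPD p q : inP p -> inP q ->
  (forall e, e \in W -> f e p = -1 -> f e q = -1 -> False) ->
  inP (p + q).
Proof.
move=> Pp Pq pq e eW; rewrite fD.
have := Pp _ eW; have := Pq _ eW.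
case: (eqVneq (f e p) (-1)) => [ep|]; last by lia.
case: (eqVneq (f e q) (-1)) => [/(pq _ eW ep) []|]; lia.
Qed.

Lemma inP_addL a q F : inP a -> ~ L a -> F \in W -> f F a = -1 ->
  inP q -> f F q <> -1 -> inP (q + a).
Proof.
move=> Pa La FW Fa Pq Fq; apply: inPD => // e eW eq ea.
by apply: Fq; rewrite (notL_unique Pa La FW eW Fa ea).
Qed.

(** Each step lowers [F] by one and is allowed while [F] is not yet tight; the last possible step
    ends on the facet. *)
Lemma inP_iter a q F k : inP a -> ~ L a -> F \in W -> f F a = -1 ->
  inP q -> 0 <= k -> k <= f F q + 1 -> inP (q + k *: a).
Proof.
move=> Pa La FW Fa Pq; case: k => // k _.
elim: k => [|k IH] kF; first by rewrite scale0r addr0.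
have -> : q + k.+1%:Z *: a = (q + k%:Z *: a) + a.
  by rewrite intS scalerDl scale1r addrAC addrA.
by apply: (inP_addL _ _ FW) => //; [apply: IH; lia | rewrite !fE Fa; lia].
Qed.

Lemma inP_opp_scale a F h : F \in W -> f F a = -1 -> 0 <= h ->
  inP (- (h *: a)) -> - (h *: a) != 0 -> h = 1.
Proof.
move=> FW Fa h0 Pa /(tight_exists Pa)[e eW]; rewrite !fE => ea.
have /(congr1 absz)/eqP : h * f e a = 1 by lia.
by rewrite abszM muln_eq1 => /andP[/eqP h1 _]; lia.
Qed.

(** If [x] were in [L], the points [m + k *: x] would all stay outside [L] and on [F], so the walk
    would never be blocked; but a form tight at [x] decreases along it without bound. *)
Lemma notL_level0 m x F : inP m -> ~ L m -> F \in W -> f F m = -1 ->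
  inP x -> x != 0 -> f F x = 0 -> ~ L x.
Proof.
move=> Pm Lm FW Fm Px x0 Fx Lx.
have [G GW Gx] := tight_exists Px x0.
have mk (k : nat) : inP (m + k%:Z *: x) /\ ~ L (m + k%:Z *: x).
  elim: k => [|k [IHP IHL]]; first by rewrite scale0r addr0.
  have -> : m + k.+1%:Z *: x = x + (m + k%:Z *: x).
    by rewrite intS scalerDl scale1r addrCA.
  split; last by move=> /L_sub /(_ Lx).
  by apply: (inP_addL _ _ FW) => //; rewrite ?fE Fx ?Fm; lia.
(* For this [k] the form [G] would take the value -2. *)
have [+ _] := mk (absz (f G m + 2)).
move=> /(_ _ GW); rewrite !fE Gx; have := Pm _ GW; lia.
Qed.

(* [a] and [x] lie in the interiors of the facets [F] and [G], and [a + x] lies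
   in the common ridge of [F] and [G]. *)
Record adj (F G : I) (a x : 'rV[int]_n) : Prop := Adj {
  adjF : F \in W; adjG : G \in W; adja : inP a; adjx : inP x;
  adjLa : ~ L a; adjLx : ~ L x;
  adjFa : f F a = -1; adjGa : f G a = 0;
  adjFx : f F x = 0; adjGx : f G x = -1 }.

Lemma adj_sym F G a x : adj F G a x -> adj G F x a.
Proof. by case=> *; split. Qed.

Lemma adj_neq F G a x : adj F G a x -> F != G.
Proof. by case=> *; apply/eqP => FG; subst G; lia. Qed.

(** Walking from a point of [L] along [m] down to [F]-level 0 gives [x]; walking from [m] along [x]
    down to [G]-level 0 gives [a]. *)
Lemma adj_exists m : inP m -> ~ L m -> exists F G a x, adj F G a x.
Proof.
move=> Pm Lm; have [F FW Fm] := tight_exists Pm (notL_neq0 Lm).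
have [w [Pw Lw Fw]] := positive_point FW FW Fm Fm.
have Px : inP (w + f F w *: m) by apply: (inP_iter _ _ FW) => //; lia.
set x := w + _ in Px; have Fx : f F x = 0 by rewrite !fE Fm; lia.
have x0 : x != 0.
  apply/eqP => /eqP; rewrite addr_eq0 => /eqP wm; apply: Lm.
  have F1 : f F w = 1.
    apply: (inP_opp_scale FW Fm); rewrite -?wm //; first by lia.
    by apply/eqP => w0; move: Fw; rewrite w0 f0.
  by rewrite -[m]opprK; apply: LN; move: wm; rewrite F1 scale1r => <-.
clearbody x; have Lx := notL_level0 Pm Lm FW Fm Px x0 Fx.
have [G GW Gx] := tight_exists Px x0.
have FG : F != G by apply/eqP => FG; rewrite -FG Fx in Gx.
have Gm := notL_ge0 Pm Lm FW GW Fm FG.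
have Pa : inP (m + f G m *: x) by apply: (inP_iter _ _ GW) => //; lia.
set a := m + _ in Pa.
have Fa : f F a = -1 by rewrite !fE Fx Fm; lia.
have Ga : f G a = 0 by rewrite !fE Gx; lia.
clearbody a; exists F, G, a, x; split => // La.
apply: (Lx); apply: (L_sub _ La).
apply: (two_tight _ FW GW FG); rewrite ?fE ?Fa ?Fx ?Ga ?Gx //.
by apply: (inP_addL _ _ GW) => //; rewrite Ga.
Qed.

(** * Coordinates of lattice points relative to two adjacent facets *)

Section Adjacent.
Variables (F G : I) (a x : 'rV[int]_n).
Hypothesis Aax : adj F G a x.

Lemma adj_add_inP : inP (a + x).
Proof. by case: Aax => *; apply: (inP_addL (F := G)) => //; lia. Qed.

Lemma adj_add_L : L (a + x).
Proof.
have := adj_add_inP; have := adj_neq Aax.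
by case: Aax => FW GW *; apply: (two_tight _ FW GW) => //; rewrite !fE; lia.
Qed.

Lemma adj_changel a' : inP a' -> f F a' = -1 -> f G a' = 0 ->
  adj F G a' x.
Proof.
have FG := adj_neq Aax; case: Aax => FW GW _ Px _ Lx _ _ Fx Gx Pa' Fa' Ga'.
split=> // La'; apply: (Lx); apply: (L_sub _ La').
apply: (two_tight _ FW GW); rewrite ?fE ?Fa' ?Fx ?Ga' ?Gx //.
by apply: (inP_addL _ _ GW) => //; rewrite Ga'.
Qed.

(* The multiples of [z] in [L] forced by the third facet [H] through [z] have
   consecutive coefficients. *)
Lemma adj_no_level00 z : inP z -> f F z = 0 -> f G z = 0 -> z = 0.
Proof.
move=> Pz Fz Gz; apply/eqP/negPn/negP => z0.
have FG := adj_neq Aax; have Lr := adj_add_L; have Pr := adj_add_inP.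
case: Aax => FW GW Pa Px La Lx Fa Ga Fx Gx.
have Lz := notL_level0 Pa La FW Fa Pz z0 Fz.
have [H HW Hz] := tight_exists Pz z0.
have FH : F != H by apply/eqP => FH; rewrite -FH Fz in Hz.
have GH : G != H by apply/eqP => GH; rewrite -GH Gz in Hz.
have Ha := notL_ge0 Pa La FW HW Fa FH; have Hx := notL_ge0 Px Lx GW HW Gx GH.
have reach q : inP q -> 0 <= f H q -> inP (q + (f H q + 1) *: z).
  by move=> Pq Hq; apply: (inP_iter _ _ HW) => //; lia.
have La' : L (a + (f H a + 1) *: z).
  apply: (two_tight _ FW HW FH); rewrite ?fE ?Fz ?Hz; try lia; exact: reach.
have Lx' : L (x + (f H x + 1) *: z).
  apply: (two_tight _ GW HW GH); rewrite ?fE ?Gz ?Hz; try lia; exact: reach.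
have Lr' : L ((a + x) + (f H (a + x) + 1) *: z).
  apply: (two_tight _ FW GW FG); rewrite ?fE ?Fz ?Gz; try lia.
  by rewrite -fD; apply: reach => //; rewrite fD; lia.
(* Here [a] and [x] cancel, and [z] keeps the coefficient [(f H a + 1) + (f H x + 1) - (f H (a + x)
   + 1) = 1]. *)
apply: Lz; have := LD (LD La' Lx') (LN Lr').
congr L; apply/rowP => j; rewrite !fE !mxE; ring.
Qed.

(** Walking [h] steps along [a] and [g] steps along [x] brings [q] to level 0 for both forms, where
    only the origin is left. *)
Lemma adj_level0 q h g : inP q -> f F q = h -> f G q = g ->
  0 <= h -> 0 <= g -> q = - (h *: a + g *: x).
Proof.
move=> Pq Fq Gq h0 g0.
case: (Aax) => FW GW Pa Px La Lx Fa Ga Fx Gx.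
have P1 : inP (q + h *: a) by apply: (inP_iter _ _ FW) => //; lia.
have P2 : inP (q + h *: a + g *: x).
  by apply: (inP_iter _ _ GW) => //; rewrite !fE Ga; lia.
have E : q + h *: a + g *: x = 0.
  by apply: adj_no_level00 => //; rewrite !fE ?Fa ?Ga ?Fx ?Gx; lia.
by apply/eqP; rewrite -addr_eq0 addrA E.
Qed.

End Adjacent.

(** If the quadrant contained only the origin, points [v + k *: x + u] with [u] at positive
    [F]-level would have to vanish, which would express [x] through elements of [L]. *)
Lemma adj_quadrant_aux F G a x v : adj F G a x -> inP v -> L v ->
  f F v = -1 -> 2 <= f G v ->
  exists q, [/\ inP q, q != 0, 0 <= f F q & 0 <= f G q].
Proof.
move=> Aax Pv Lv Fv Gv; apply: NNPP => NE.
have zero q : inP q -> 0 <= f F q -> 0 <= f G q -> q = 0.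
  by move=> Pq Fq Gq; apply/eqP/negPn/negP => q0; apply: NE; exists q.
case: (Aax) => FW GW Pa Px La Lx Fa Ga Fx Gx.
have [u [Pu Lu Fu]] := positive_point FW FW Fa Fa.
have Gu : f G u = -1.
  have := Pu _ GW; case: (eqVneq (f G u) (-1)) => // Gu1 Gu2.
  have u0 : u = 0 by apply: zero => //; lia.
  by move: Fu; rewrite u0 f0.
have Pvx k : 0 <= k -> k <= f G v + 1 -> inP (v + k *: x).
  by move=> *; apply: (inP_iter _ _ GW).
have sum k : 1 <= k -> k <= f G v - 1 -> inP (v + k *: x + u).
  move=> k1 kg; apply: inPD => //; first by apply: Pvx; lia.
  move=> e eW; rewrite !fE => ev eu.
  have Fe : F != e by apply/eqP => Fe; subst e; lia.
  have Ge : G != e by apply/eqP => Ge; subst e; rewrite Gx in ev; lia.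
  have ex := notL_ge0 Px Lx GW eW Gx Ge.
  have ev1 := Pv _ eW.
  (* Since [k >= 1], the equation [f e v + k * f e x = -1] forces both bounds to be attained. Then
     [e] and [F] are both tight at [v + f G v *: x], which [adj_changel] places outside [L]. *)
  have ex0 : f e x = 0 by nia.
  have Pvg : inP (v + f G v *: x) by apply: Pvx; lia.
  have [||_ _ _ _ + _ _ _ _ _] := adj_changel Aax Pvg.
  - by rewrite !fE Fx; lia.
  - by rewrite !fE Gx; lia.
  by apply; apply: (two_tight Pvg FW eW Fe); rewrite !fE ?Fx ?ex0; lia.
have E1 : v + (f G v - 1) *: x + u = 0.
  by apply: zero; [apply: sum; lia | rewrite !fE ?Fx ?Gx; lia..].
have Fu1 : f F u = 1 by have := congr1 (f F) E1; rewrite !fE Fx; lia.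
(* Otherwise two consecutive values of [k] are admissible, and both sums would vanish although they
   differ by [x]. *)
have Gv2 : f G v = 2.
  apply/eqP/negPn/negP => Gv2.
  have E2 : v + (f G v - 2) *: x + u = 0.
    by apply: zero; [apply: sum; lia | rewrite !fE ?Fx ?Gx; lia..].
  by have := congr1 (f G) E2; rewrite !fE Gx; lia.
apply: Lx; apply: (@L_sub (v + u)); last exact: LD.
by move: E1; rewrite Gv2 scale1r addrAC => ->.
Qed.

(** A point with positive [f F v + f G v] is in the quadrant itself unless one form is tight there;
    the other is then at least 2. *)
Lemma adj_quadrant F G a x : adj F G a x ->
  exists q, [/\ inP q, q != 0, 0 <= f F q & 0 <= f G q].
Proof.
move=> Aax; have Pr := adj_add_inP Aax.
case: (Aax) => FW GW Pa Px La Lx Fa Ga Fx Gx.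
have [||v [Pv Lv FGv]] := @positive_point F G (a + x) FW GW.
- by rewrite fD Fa Fx.
- by rewrite fD Ga Gx.
have := Pv _ FW; have := Pv _ GW.
case: (eqVneq (f F v) (-1)) => [Fv|Fv].
  by move=> *; apply: (adj_quadrant_aux Aax Pv) => //; lia.
case: (eqVneq (f G v) (-1)) => [Gv|Gv].
  move=> *; have [|q [Pq q0 Gq Fq]] := adj_quadrant_aux (adj_sym Aax) Pv Lv Gv.
    by lia.
  by exists q.
move=> Gv1 Fv1; exists v; split=> //; [|lia..].
by apply/eqP => v0; move: FGv; rewrite v0 !f0.
Qed.

(** A nonzero quadrant point is [- (h *: a + g *: x)]; walking along [a] and [x] cancels all but a
    single vector. *)
Lemma adj_opp F G a x : adj F G a x -> inP (- a) \/ inP (- x).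
Proof.
move=> Aax; have [q [Pq q0 Fq Gq]] := adj_quadrant Aax.
have Eq := adj_level0 Aax Pq erefl erefl Fq Gq.
case: (Aax) => FW GW Pa Px La Lx Fa Ga Fx Gx.
case: (eqVneq (f F q) 0) => [F0|F0].
  have G0 : f G q != 0.
    by apply: contra q0 => /eqP G0; rewrite Eq F0 G0 !scale0r addr0 oppr0.
  right; have -> : - x = q + (f G q - 1) *: x.
    by rewrite {1}Eq F0; apply/rowP => j; rewrite !mxE; ring.
  by apply: (inP_iter _ _ GW) => //; lia.
left; have -> : - a = q + (f F q - 1) *: a + f G q *: x.
  by rewrite {1}Eq; apply/rowP => j; rewrite !mxE; ring.
apply: (inP_iter _ _ GW) => //; last by rewrite !fE Ga; lia.
by apply: (inP_iter _ _ FW) => //; lia.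
Qed.

Lemma adj_opp_pivot F G a x : adj F G a x -> inP (- a) ->
  exists H y z, [/\ adj H G (- a) y, adj F G a z & z != x].
Proof.
move=> Aax Pna; have Pr := adj_add_inP Aax; have FG := adj_neq Aax.
case: (Aax) => FW GW Pa Px La Lx Fa Ga Fx Gx.
have Lna : ~ L (- a) by move=> /LN; rewrite opprK.
have [H HW Ha] := tight_exists Pna (notL_neq0 Lna).
have FH : F != H by apply/eqP => FH; move: Ha; rewrite -FH fN Fa.
have GH : G != H by apply/eqP => GH; move: Ha; rewrite -GH fN Ga.
have Hx := notL_ge0 Px Lx GW HW Gx GH.
have Hr : -1 < f H (a + x) by move: Ha; rewrite !fE; lia.
have [|||r [Pr' r0 Fr Gr Hr']] := ridge_point FW GW HW Pr _ _ Hr.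
- by rewrite fD Fa Fx.
- by rewrite fD Ga Gx.
(* Forms other than [F] and [G] are nonnegative at both [a] and [x], so they are not tight at
   [a + x]. *)
- move=> e eW; rewrite fD => er.
  case: (eqVneq F e) => [|Fe]; first by left.
  case: (eqVneq G e) => [|Ge]; first by right.
  have := notL_ge0 Pa La FW eW Fa Fe; have := notL_ge0 Px Lx GW eW Gx Ge; lia.
exists H, (x + f H x *: (- a)), (r - a); split.
- have Py : inP (x + f H x *: (- a)) by apply: (inP_iter _ _ HW) => //; lia.
  split=> //; rewrite ?(fD, fZ) ?Ha ?fN ?Ga ?Gx; try lia.
  move=> Ly; apply: (Lna); apply: (L_sub _ Ly); apply: (two_tight _ GW HW GH).
  + by apply: (inP_addL _ _ HW) => //; rewrite fD fZ Ha; lia.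
  + by rewrite !fE Ga; lia.
  + by move: Ha; rewrite !fE => Ha; nia.
- have Pz : inP (r - a) by apply: (inP_addL _ _ HW) => //; lia.
  apply: adj_sym; apply: (adj_changel (adj_sym Aax)) => //.
    by rewrite fD fN Gr Ga.
  by rewrite fD fN Fr Fa.
- by rewrite subr_eq addrC.
Qed.

(** [q] has the same coefficients relative to [a, x] and to [a, z] with [z != x], so the second
    coefficient vanishes. *)
Lemma adj_opp_unique F G a x q : adj F G a x -> inP (- a) ->
  inP q -> q != 0 -> 0 <= f F q -> 0 <= f G q -> q = - a.
Proof.
move=> Aax Pna Pq q0 Fq Gq.
have [H [y [z [_ Aaz zx]]]] := adj_opp_pivot Aax Pna.
have Ex := adj_level0 Aax Pq erefl erefl Fq Gq.
have Ez := adj_level0 Aaz Pq erefl erefl Fq Gq.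
have /eqP : f G q *: (z - x) = 0.
  move: Ex; rewrite {1}Ez => /oppr_inj/addrI => E.
  by rewrite scalerBr E subrr.
rewrite scale_row_eq0 subr_eq0 (negPf zx) orbF => /eqP G0.
have {}Ex : q = - (f F q *: a) by rewrite {1}Ex G0 scale0r addr0.
case: (Aax) => FW _ _ _ _ _ Fa _ _ _.
by rewrite Ex (inP_opp_scale FW Fa Fq) -?Ex // scale1r.
Qed.

Lemma no_adj_opp F G a x : adj F G a x -> ~ inP (- a).
Proof.
move=> Aax Pna; have [H [y [z [Hay Faz zx]]]] := adj_opp_pivot Aax Pna.
have FG := adj_neq Aax.
case: (Aax) => FW GW Pa Px La Lx Fa Ga Fx Gx.
case: (Hay) => HW _ _ _ Lna _ Ha _ _ _.
have FH : F != H by apply/eqP => FH; move: Ha; rewrite -FH fN Fa.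
have Pnna : inP (- - a) by rewrite opprK.
have [w [Pw Lw Gw]] := positive_point GW GW Gx Gx.
have w0 : w != 0 by apply/eqP => w0; move: Gw; rewrite w0 f0.
have Fw : f F w = -1.
  have := Pw _ FW; case: (eqVneq (f F w) (-1)) => // *.
  by case: Lna; rewrite -(adj_opp_unique Aax Pna Pw w0) //; lia.
have Hw : f H w = -1.
  have := Pw _ HW; case: (eqVneq (f H w) (-1)) => // *.
  by case: La; rewrite -[a]opprK -(adj_opp_unique Hay Pnna Pw w0) //; lia.
(* The endpoint is on [F] at [G]-level 0, hence outside [L] and nonnegative for [H]; uniqueness for
   the pair [H, G] identifies it. *)
have walk t : adj F G a t -> w + f G w *: t = a.
  move=> Aat; case: (Aat) => _ _ _ Pt _ Lt _ _ Ft Gt.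
  have Pq : inP (w + f G w *: t) by apply: (inP_iter _ _ GW) => //; lia.
  have Fq : f F (w + f G w *: t) = -1 by rewrite !fE Ft; lia.
  have Gq : f G (w + f G w *: t) = 0 by rewrite !fE Gt; lia.
  have [_ _ _ _ Lq _ _ _ _ _] := adj_changel Aat Pq Fq Gq.
  rewrite -[RHS]opprK; apply: (adj_opp_unique Hay Pnna Pq (notL_neq0 Lq)).
  - exact: (notL_ge0 Pq Lq FW HW Fq FH).
  - by rewrite Gq.
have /eqP : f G w *: (z - x) = 0.
  by rewrite scalerBr -[_ *: z](addKr w) walk // -(walk _ Aax) addKr subrr.
by rewrite scale_row_eq0 subr_eq0 (negPf zx) orbF => /eqP; lia.
Qed.

Lemma inP_L m : inP m -> L m.
Proof.
move=> Pm; apply: NNPP => Lm; have [F [G [a [x Aax]]]] := adj_exists Pm Lm.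
case: (adj_opp Aax) => [/(no_adj_opp Aax) //|].
exact: no_adj_opp (adj_sym Aax).
Qed.

End LatticePoints.


(** * Convex hulls and duality *)

Section RealPairing.
Variables (R : realType) (n : nat).
Implicit Types u x : 'rV[R]_n.

(* Rewriting with the generic lemmas leaves a ring structure on [R] that is
   only convertible to the one inferred here, and [lra] tells them apart. *)
Lemma rpairingDr u x y : pairing u (x + y) = pairing u x + pairing u y.
Proof. exact: pairingDr. Qed.
Lemma rpairingZr u k x : pairing u (k *: x) = k * pairing u x.
Proof. exact: pairingZr. Qed.
Lemma rpairingNr u x : pairing u (- x) = - pairing u x.
Proof. exact: pairingNr. Qed.
Lemma rpairing0r u : pairing u 0 = 0.
Proof. exact: pairing0r. Qed.
Lemma rpairingC u x : pairing u x = pairing x u.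
Proof. exact: pairingC. Qed.

Lemma pairing_sumr u m (F : 'I_m -> 'rV[R]_n) :
  pairing u (\sum_i F i) = \sum_i pairing u (F i).
Proof.
by apply: (big_morph (pairing u)); [exact: rpairingDr | exact: rpairing0r].
Qed.

Lemma pairing_ge0 u : 0 <= pairing u u.
Proof. by apply: sumr_ge0 => i _; rewrite -expr2 sqr_ge0. Qed.

Lemma pairing_eq0 u : (pairing u u == 0) = (u == 0).
Proof.
apply/idP/eqP => [|->]; last by rewrite rpairing0r.
rewrite psumr_eq0 => [/allP u0|i _]; last by rewrite -expr2 sqr_ge0.
apply/rowP => i; have := u0 i (mem_index_enum i).
by rewrite mulf_eq0 orbb !mxE => /eqP.
Qed.

Lemma pairing_gt0 u : u != 0 -> 0 < pairing u u.
Proof. by rewrite lt_def pairing_eq0 pairing_ge0 => ->. Qed.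

End RealPairing.

(** Induction on the number of generators: if the [y] separating [b] from the tail is negative on
    [a], project along [a] onto the kernel of [y]. Coefficients are indexed by [nat] so that they
    transfer between a list and its image. *)
Lemma farkas (R : realType) n (s : seq 'rV[R]_n) b :
  (exists2 lam : nat -> R, forall i, 0 <= lam i
    & b = \sum_(i < size s) lam i *: nth 0 s i) \/
  (exists2 y, forall a, a \in s -> 0 <= pairing y a & pairing y b < 0).
Proof.
have [k] := ubnP (size s); elim: k s b => // k IH [|a s] b sk.
  case: (eqVneq b 0) => [->|b0].
    by left; exists (fun=> 0) => //; rewrite big_ord0.
  by right; exists (- b) => //; rewrite pairingNl oppr_lt0 pairing_gt0.
have [[lam lam0 ->]|[y ys yb]] := IH s b sk.
  left; exists (fun i => if i is i'.+1 then lam i' else 0); first by case.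
  by rewrite big_ord_recl scale0r add0r.
have [ya|ya] := leP 0 (pairing y a).
  by right; exists y => // w; rewrite inE => /predU1P[->|/ys].
pose rho v := pairing y v / pairing y a.
pose proj v := v - rho v *: a.
have [|[lam lam0]|[z zs zb]] := IH (map proj s) (proj b).
- by rewrite size_map.
- rewrite size_map => E; left.
  (* The coefficient of [a] collects what the projection removed; it is nonnegative because
     [rho b > 0] and [rho] is nonpositive on [s]. *)
  exists (fun i => if i is i'.+1 then lam i'
                   else rho b - \sum_(i < size s) lam i * rho (nth 0 s i)).
    case=> // ; rewrite subr_ge0 (@le_trans _ _ 0) //.
      apply: sumr_le0 => i _; rewrite mulr_ge0_le0 // /rho.
      by rewrite mulr_ge0_le0 ?ys ?mem_nth // invr_le0 ltW.
    by rewrite /rho mulr_le0 // ?invr_le0 ltW.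
  rewrite big_ord_recl /= scalerBl scaler_suml.
  move: E => /eqP; rewrite subr_eq => /eqP {1}->.
  rewrite addrC -[RHS]addrA; congr (_ + _).
  rewrite -sumrN -big_split; apply: eq_bigr => i _ /=.
  by rewrite (nth_map 0) // scalerBr scalerA addrC.
right; pose w := z - (pairing z a / pairing y a) *: y.
have wE v : pairing w v = pairing z (proj v).
  rewrite /w /proj /rho pairingDl pairingNl pairingZl rpairingDr rpairingNr.
  by rewrite rpairingZr; field; rewrite lt_eqF.
exists w; last by rewrite wE.
move=> v; rewrite inE => /predU1P[->|vs]; last first.
  by rewrite wE; apply/zs/map_f.
by rewrite wE /proj /rho divff ?lt_eqF // scale1r subrr rpairing0r.
Qed.

Section Conv.
Variables (R : realType) (n : nat).
Local Notation tr := (@to_real R n).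
Implicit Types (V : seq 'rV[int]_n) (u x : 'rV[R]_n).

Lemma to_realE (u x : 'rV[int]_n) : pairing (tr u) (tr x) = (pairing u x)%:~R.
Proof.
rewrite {2}/pairing rmorph_sum; apply: eq_bigr => i _.
by rewrite !mxE /= intrM.
Qed.

Lemma to_real0 : tr 0 = 0.
Proof. exact: map_mx0. Qed.

Lemma to_real_inj : injective tr.
Proof.
by move=> u v /rowP uv; apply/rowP => j; have := uv j; rewrite !mxE => /intr_inj.
Qed.

Lemma to_real_eq0 (v : 'rV[int]_n) : (tr v == 0) = (v == 0).
Proof. by rewrite -to_real0 (inj_eq to_real_inj). Qed.

(** A point where [u] attains its lower bound has weight only on generators where [u] attains it. *)
Lemma conv_face V x u c c' w : conv V x ->
  (forall v, v \in V -> c <= pairing u (tr v)) -> pairing u x <= c ->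
  (forall v, v \in V -> pairing u (tr v) = c -> c' <= pairing w (tr v)) ->
  c' <= pairing w x.
Proof.
move=> [lam [lam0 lam1 ->]] uc; rewrite !pairing_sumr => xc wc.
have uv (i : 'I_(size V)) : lam i * (pairing u (tr (nth 0 V i)) - c) = 0.
  have pos (j : 'I_(size V)) :
      true -> 0 <= lam j * (pairing u (tr (nth 0 V j)) - c).
    by move=> _; rewrite mulr_ge0 // subr_ge0 uc ?mem_nth.
  have : \sum_j lam j * (pairing u (tr (nth 0 V j)) - c) == 0.
    rewrite eq_le sumr_ge0 // andbT.
    under eq_bigr do rewrite mulrBr.
    rewrite sumrB -mulr_suml lam1 mul1r subr_le0 (le_trans _ xc) //.
    by apply: ler_sum => j _; rewrite rpairingZr.
  by rewrite psumr_eq0 // => /allP/(_ i (mem_index_enum _))/eqP.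
rewrite -[c']mul1r -lam1 mulr_suml; apply: ler_sum => i _.
rewrite rpairingZr; have /eqP := uv i; rewrite mulf_eq0 => /orP[/eqP->|].
  by rewrite !mul0r.
by rewrite subr_eq0 => /eqP/wc wi; rewrite ler_wpM2l // wi ?mem_nth.
Qed.

Lemma conv_lb V x u c : conv V x ->
  (forall v, v \in V -> c <= pairing u (tr v)) -> c <= pairing u x.
Proof.
move=> Vx uc; apply: (@conv_face V x 0 0) => // [v _||v vV _].
- by rewrite pairing0l.
- by rewrite pairing0l.
- exact: uc.
Qed.

(** Farkas' lemma one dimension up: an added coordinate 1 turns convex combinations into conic ones,
    and its dual variable gives the threshold. *)
Lemma conv_sep V x : ~ conv V x -> exists u c,
  (forall v, v \in V -> c <= pairing u (tr v)) /\ pairing u x < c.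
Proof.
move=> Vx; pose lift (w : 'rV[R]_n) : 'rV[R]_(n + 1) := row_mx w 1%:M.
have liftE (y : 'rV[R]_(n + 1)) w :
    pairing y (lift w) = pairing (lsubmx y) w + rsubmx y 0 0.
  rewrite /pairing big_split_ord big_ord1; congr (_ + _).
    by apply: eq_bigr => i _; rewrite row_mxEl mxE.
  by rewrite row_mxEr !mxE mulr1.
have [[lam lam0 E]|[y ys yb]] :=
    farkas [seq lift (tr v) | v <- V] (lift x).
  have {E}E : lift x = \sum_(i < size V) lam i *: lift (tr (nth 0 V i)).
    by rewrite E size_map; apply: eq_bigr => i _; rewrite (nth_map 0).
  case: Vx; exists (fun i => lam i); split=> //.
    move/(congr1 rsubmx): E; rewrite row_mxKr linear_sum => /matrixP/(_ 0 0).
    rewrite summxE mxE eqxx mulr1n => ->; apply: eq_bigr => i _.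
    by rewrite linearZ /= row_mxKr !mxE mulr1.
  move/(congr1 lsubmx): E; rewrite row_mxKl linear_sum => ->.
  by apply: eq_bigr => i _; rewrite linearZ /= row_mxKl.
exists (lsubmx y), (- rsubmx y 0 0); split=> [v vV|].
  by rewrite -subr_ge0 opprK -liftE; apply/ys/map_f.
by rewrite -subr_lt0 opprK -liftE.
Qed.

Lemma conv_hull V x :
  (forall u c, (forall v, v \in V -> c <= pairing u (tr v)) ->
     c <= pairing u x) -> conv V x.
Proof.
move=> Vx; apply: NNPP => /conv_sep[u [c [/Vx uc]]].
by rewrite ltNge uc.
Qed.

Lemma conv_mem V v : v \in V -> conv V (tr v).
Proof. by move=> vV; apply: conv_hull => u c; apply. Qed.

End Conv.


(** * Uniformly small steps and bounds over finite lists *)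

Section SmallSteps.
Variables (R : realType).

Lemma small_uniform (T : eqType) (s : seq T) (Q : T -> R -> Prop) :
  (forall e, e \in s ->
     exists2 t, 0 < t & forall t', 0 < t' -> t' <= t -> Q e t') ->
  exists2 t, 0 < t & forall e t', e \in s -> 0 < t' -> t' <= t -> Q e t'.
Proof.
elim: s => [|a s IH] sQ; first by exists 1.
have [|t t0 tQ] := IH; first by move=> e es; apply: sQ; rewrite inE es orbT.
have [t1 t10 t1Q] := sQ a (mem_head a s).
exists (Num.min t t1) => [|e t']; first by rewrite lt_min t0.
rewrite inE le_min => /predU1P[->|es] t'0 /andP[t't t't1]; first exact: t1Q.
exact: tQ.
Qed.

Lemma seq_lower_bound (T : eqType) (s : seq T) (g : T -> R) :
  exists c, forall v, v \in s -> c <= g v.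
Proof.
elim: s => [|a s [c cs]]; first by exists 0.
exists (Num.min c (g a)) => v; rewrite inE ge_min.
by case/predU1P => [->|/cs ->//]; rewrite lexx orbT.
Qed.

Lemma small_slope (a b : R) : 0 < a ->
  exists2 t, 0 < t & forall t', 0 < t' -> t' <= t -> 0 < a + t' * b.
Proof.
move=> a0; have b0 : 0 < 1 + `|b| by rewrite ltr_pwDl.
exists (a / (1 + `|b|)); first by rewrite divr_gt0.
move=> t' t'0; rewrite ler_pdivlMr // mulrDr mulr1 => t'a.
have /(ler_wpM2l (ltW t'0)) := ler_norm (- b).
by rewrite normrN mulrN; lra.
Qed.

End SmallSteps.

(** * Moving inside a polytope given by inequalities *)

Section Polytope.
Variables (R : realType) (n : nat).
Local Notation tr := (@to_real R n).

Lemma interior_ray (P : 'rV[R]_n -> Prop) d : origin_interior P ->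
  exists2 t, 0 < t & P (t *: d).
Proof.
move=> [eps eps0 Peps].
have pos : 0 < 1 + \sum_j `|d 0 j| by rewrite ltr_pwDl // sumr_ge0.
exists (eps / (1 + \sum_j `|d 0 j|)); first by rewrite divr_gt0.
apply: Peps => j; rewrite mxE normrM ger0_norm ?divr_ge0 1?ltW //.
rewrite mulrAC ltr_pdivrMr // ltr_pM2l // ltr_pwDl //.
by rewrite (bigD1 j) //= lerDl sumr_ge0.
Qed.

Lemma kernel_vector k (A : 'M[R]_(n, k)) : (k < n)%N ->
  exists2 d : 'rV[R]_n, d != 0 & d *m A = 0.
Proof.
move=> kn; have kn0 : kermx A != 0.
  rewrite -mxrank_eq0 mxrank_ker subn_eq0 -ltnNge.
  exact: leq_ltn_trans (rank_leq_col A) kn.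
exists (nz_row (kermx A)); first by rewrite nz_row_eq0.
by apply/sub_kermxP; exact: nz_row_sub.
Qed.

Lemma mulmx_tr_pairing (d u : 'rV[R]_n) : (d *m u^T == 0) = (pairing u d == 0).
Proof.
have E : (d *m u^T) 0 0 = pairing u d.
  by rewrite mxE; apply: eq_bigr => i _; rewrite mxE mulrC.
apply/eqP/eqP => [E'|E0]; first by rewrite -E E' mxE.
by apply/matrixP => i j; rewrite !ord1 E E0 mxE.
Qed.

Lemma kernel_vector2 (u w : 'rV[R]_n) : (2 < n)%N ->
  exists d, [/\ d != 0, pairing u d = 0 & pairing w d = 0].
Proof.
move=> n2; have [d d0] := kernel_vector (row_mx u^T w^T) n2.
rewrite mul_mx_row -row_mx0 => /eq_row_mx[/eqP + /eqP].
by rewrite !mulmx_tr_pairing => /eqP ? /eqP ?; exists d.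
Qed.

Variable W : seq 'rV[int]_n.
Definition dualP (x : 'rV[R]_n) := forall e, e \in W -> -1 <= pairing (tr e) x.

Lemma dualP_int (m : 'rV[int]_n) :
  dualP (tr m) <-> forall e, e \in W -> -1 <= pairing e m.
Proof.
have E e : (-1 <= pairing (tr e) (tr m)) = (-1 <= pairing e m).
  by rewrite to_realE -(ler_int R) rmorphN1.
by split=> Pm e /Pm; rewrite E.
Qed.

Lemma tight_int (e m : 'rV[int]_n) :
  pairing (tr e) (tr m) = -1 <-> pairing e m = -1.
Proof.
rewrite to_realE; split => [/eqP|-> //].
by rewrite -(rmorphN1 (intmul 1)) eqr_int => /eqP.
Qed.

(** Forms that are not tight at [x] leave slack for a short step. Knowing which forms are tight
    afterwards later yields relatively interior points of faces. *)
Lemma dualP_step x d : dualP x ->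
  (forall e, e \in W -> pairing (tr e) x = -1 -> 0 <= pairing (tr e) d) ->
  exists2 t, 0 < t & forall t', 0 < t' -> t' <= t -> dualP (x + t' *: d) /\
    forall e, e \in W -> pairing (tr e) (x + t' *: d) = -1 ->
      pairing (tr e) x = -1 /\ pairing (tr e) d = 0.
Proof.
move=> Px xd; pose Q e (t : R) := -1 <= pairing (tr e) (x + t *: d) /\
  (pairing (tr e) (x + t *: d) = -1 ->
    pairing (tr e) x = -1 /\ pairing (tr e) d = 0).
have [e eW|t t0 tQ] := @small_uniform R _ W Q; last first.
  exists t => // t' t'0 t't; split=> [e eW|e eW].
    by case: (tQ e t').
  by case: (tQ e t').
rewrite /Q; have [ex|ex] := eqVneq (pairing (tr e) x) (-1).
  exists 1 => // t' t'0 _; have := xd e eW ex.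
  rewrite rpairingDr rpairingZr ex => ed; split.
    by rewrite lerDl mulr_ge0 // ltW.
  move=> /eqP; rewrite -subr_eq0 addrAC subrr add0r mulf_eq0 gt_eqF //=.
  by move/eqP.
have ex1 : 0 < pairing (tr e) x + 1.
  by have := Px e eW; rewrite le_eqVlt eq_sym (negPf ex) /=; lra.
have [t t0 tE] := small_slope (pairing (tr e) d) ex1.
exists t => // t' t'0 t't; have := tE t' t'0 t't.
rewrite rpairingDr rpairingZr => pos; split; first by lra.
by move=> E; move: pos; rewrite addrAC E addNr ltxx.
Qed.

End Polytope.


(** A half-space separating [x] from the hull has [c < 0], the origin being interior; rescaled, its
    normal lies in the dual, hence in the hull of [W]. *)
Lemma bipolar (R : realType) n (V W : seq 'rV[int]_n) :
  origin_interior (@conv R n V) ->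
  (forall u, dual (@conv R n V) u <-> @conv R n W u) ->
  forall x, @conv R n V x <-> dualP W x.
Proof.
move=> VO VW x; split=> [Vx e eW|Wx].
  by have /VW := conv_mem R eW; apply.
apply: conv_hull => u c uc; rewrite leNgt; apply/negP => xc.
have [u0|u0] := eqVneq u 0.
  have [t t0 Vt] := interior_ray 0 VO.
  have := conv_lb Vt uc; move: xc; rewrite u0 !pairing0l => c0 c0'.
  by have := le_lt_trans c0' c0; rewrite ltxx.
have c0 : c < 0.
  have [t t0 Vt] := interior_ray (- u) VO.
  apply: le_lt_trans (conv_lb Vt uc) _.
  by rewrite rpairingZr rpairingNr mulrN oppr_lt0 mulr_gt0 // pairing_gt0.
have /VW Wu : dual (conv V) ((- c)^-1 *: u).
  move=> m Vm; rewrite pairingZl -ler_pdivrMl ?invr_gt0 ?oppr_gt0 //.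
  by rewrite invrK mulrN1 opprK; apply: conv_lb Vm uc.
have := @conv_lb _ _ _ _ x (-1) Wu.
rewrite rpairingC pairingZl -ler_pdivrMl ?invr_gt0 ?oppr_gt0 //.
rewrite invrK mulrN1 opprK leNgt xc => /(_ _)/negP; apply=> // v vW.
by rewrite rpairingC; apply: Wx.
Qed.

(** * Tight forms, vertices and ridges of a reflexive polytope *)

Section Reflexive.
Variables (R : realType) (n : nat) (V W : seq 'rV[int]_n).
Hypothesis VW : forall x, @conv R n V x <-> dualP W x.
Local Notation tr := (@to_real R n).
Local Notation P := (@dualP R n W).

(** Otherwise integrality makes every form nonnegative at [m], and the whole ray through [m] lies in
    a bounded set. *)
Lemma dualP_tight_exists (m : 'rV[int]_n) : P (tr m) -> m != 0 ->
  exists2 e, e \in W & pairing e m = -1.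
Proof.
move=> Pm m0; apply: NNPP => no.
have em e : e \in W -> 0 <= pairing (tr e) (tr m).
  move=> eW; rewrite to_realE ler0z.
  have := (dualP_int R W m).1 Pm e eW.
  by case: (eqVneq (pairing e m) (-1)) => [em|]; [case: no; exists e | lia].
have [c Vc] := @seq_lower_bound R _ V (fun v => pairing (- tr m) (tr v)).
have m1 : 0 < pairing (tr m) (tr m) by rewrite pairing_gt0 // to_real_eq0.
pose t := (1 + `|c|) / pairing (tr m) (tr m).
have /VW Vt : P (t *: tr m).
  move=> e eW; rewrite rpairingZr (@le_trans _ _ 0) // ?lerN10 //.
  by rewrite mulr_ge0 ?em // divr_ge0 ?addr_ge0 // ltW.
have := conv_lb Vt Vc; rewrite rpairingZr pairingNl mulrN divfK ?gt_eqF //.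
by have := ler_norm (- c); rewrite normrN; lra.
Qed.

Hypothesis n_gt2 : (2 < n)%N.

Definition two_tight (m : 'rV[int]_n) := exists F G,
  [/\ F \in W, G \in W, F != G, pairing F m = -1 & pairing G m = -1].

Lemma one_tight_direction (m : 'rV[int]_n) : ~ two_tight m ->
  exists2 d : 'rV[R]_n, d != 0 & forall e, e \in W -> pairing (tr e) (tr m) = -1 ->
    pairing (tr e) d = 0.
Proof.
move=> m2; have [[e [eW em]]|no] :=
  classic (exists e, e \in W /\ pairing e m = -1).
  have [d [d0 ed _]] := kernel_vector2 (tr e) 0 n_gt2.
  exists d => // e' e'W /tight_int e'm; case: (eqVneq e e') => [<- //|ee'].
  by case: m2; exists e, e'.
have [d [d0 _ _]] := @kernel_vector2 R n 0 0 n_gt2.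
by exists d => // e eW /tight_int em; case: no; exists e.
Qed.

(* A point of [V1] on fewer than two facets is the midpoint of a segment in the
   polytope, so that [V1] generates the same polytope without it. *)
Lemma conv_two_tight : exists V',
  (forall v, v \in V' -> P (tr v) /\ two_tight v) /\
  (forall x, P x -> conv V' x).
Proof.
suff red k V1 : (size V1 < k)%N -> (forall v, v \in V1 -> P (tr v)) ->
    (forall x, P x -> conv V1 x) -> exists V',
    (forall v, v \in V' -> P (tr v) /\ two_tight v) /\
    (forall x, P x -> conv V' x).
  apply: (@red (size V).+1 V) => // [v vV|x /VW //].
  by apply/VW; exact: conv_mem.
elim: k V1 => // k IH V1 sV V1P PV1.
have [all2|] := classic (forall v, v \in V1 -> two_tight v).
  by exists V1; split=> // v vV; split; [exact: V1P | exact: all2].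
move=> not2; have [v nv] := not_all_ex_not _ _ not2.
have [vV v2] := imply_to_and _ _ nv.
apply: (IH [seq w <- V1 | w != v]).
- rewrite size_filter; apply: (@leq_trans (size V1)) => //.
  rewrite -(count_predC (pred1 v) V1) addnC -addn1 leq_add2l.
  by rewrite -has_count; apply/hasP; exists v => //=.
- by move=> w; rewrite mem_filter => /andP[_ /V1P].
move=> x Px; apply: conv_hull => u c uc.
apply: (conv_lb (PV1 x Px)) => w wV; case: (eqVneq w v) => [->|wv]; last first.
  by apply: uc; rewrite mem_filter wv.
rewrite leNgt; apply/negP => vc.
have [d [d0 ud ed]] : exists d : 'rV[R]_n, [/\ d != 0, pairing u d <= 0 &
    forall e, e \in W -> pairing (tr e) (tr v) = -1 -> pairing (tr e) d = 0].
  have [d d0 ed] := one_tight_direction v2.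
  have [ud|/ltW ud] := leP (pairing u d) 0; first by exists d.
  exists (- d); rewrite oppr_eq0 rpairingNr oppr_le0; split=> // e eW ev.
  by rewrite rpairingNr ed // oppr0.
have [|t t0 tP] := @dualP_step R n W (tr v) d (V1P v vV).
  by move=> e eW /(ed e eW) ->.
have [/PV1 Vt _] := tP t t0 (lexx t).
(* [v] is the only minimizer of [u] in [V1], so no functional can be smaller at [v + t *: d] than at
   [v]; yet [- d] is. *)
have := @conv_face _ _ _ _ u (pairing u (tr v)) (pairing (- d) (tr v)) (- d) Vt.
have -> : (pairing (- d) (tr v) <= pairing (- d) (tr v + t *: d)) = false.
  rewrite rpairingDr rpairingZr lerDl pairingNl mulrN oppr_ge0 leNgt.
  by rewrite mulr_gt0 ?pairing_gt0.
move=> H.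
have far w' : w' \in V1 -> w' != v -> pairing u (tr v) < pairing u (tr w').
  move=> w'V w'v; apply: lt_le_trans vc _.
  by apply: uc; rewrite mem_filter w'v.
suff : false by [].
apply: H => [w' w'V||w' w'V].
- by case: (eqVneq w' v) => [-> //|w'v]; exact/ltW/far.
- by rewrite rpairingDr rpairingZr gerDl mulr_ge0_le0 // ltW.
- case: (eqVneq w' v) => [->|w'v]; first by rewrite pairingNl.
  by move=> E; have := far w' w'V w'v; rewrite E ltxx.
Qed.

Lemma dualP_ray (d : 'rV[R]_n) : exists2 t, 0 < t & P (t *: d).
Proof.
have P0 : P 0 by move=> e eW; rewrite rpairing0r lerN10.
have [e eW|t t0 tP] := @dualP_step R n W 0 d P0.
  by rewrite rpairing0r => /eqP; rewrite eq_sym oppr_eq0 oner_eq0.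
by exists t => //; have [] := tP t t0 (lexx t); rewrite add0r.
Qed.

(** A small multiple of [- r] is in the polytope and has a positive sum of the two forms. *)
Lemma positive_vertex V' F G (r : 'rV[int]_n) : (forall x, P x -> conv V' x) ->
  pairing F r = -1 -> pairing G r = -1 ->
  exists2 v, v \in V' & 0 < pairing F v + pairing G v.
Proof.
move=> PV' Fr Gr; apply: NNPP => no.
have [t t0 /PV' Vt] := dualP_ray (- tr r).
have := @conv_lb _ _ _ _ (- (tr F + tr G)) 0 Vt.
rewrite pairingNl pairingDl !rpairingZr !rpairingNr !to_realE Fr Gr.
rewrite leNgt oppr_lt0 rmorphN1 opprK mulr1 addr_gt0 // => H.
suff : false by [].
apply: H => v vV; rewrite pairingNl pairingDl !to_realE -intrD oppr_ge0 lerz0.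
by rewrite leNgt; apply/negP => Fv; apply: no; exists v.
Qed.

Lemma second_ridge_point F G H (r : 'rV[int]_n) :
  F \in W -> G \in W -> H \in W -> P (tr r) -> pairing F r = -1 -> pairing G r = -1 -> -1 < pairing H r ->
  (forall e, e \in W -> pairing e r = -1 -> e = F \/ e = G) ->
  exists r', [/\ P (tr r'), r' != r, pairing F r' = -1, pairing G r' = -1
    & -1 < pairing H r'].
Proof.
move=> FW GW HW Pr Fr Gr Hr FGr; apply: NNPP => no.
have [d [d0 Fd Gd Hd]] : exists d : 'rV[R]_n, [/\ d != 0,
    pairing (tr F) d = 0, pairing (tr G) d = 0 & 0 <= pairing (tr H) d].
  have [d [d0 Fd Gd]] := kernel_vector2 (tr F) (tr G) n_gt2.
  have [Hd|/ltW Hd] := leP 0 (pairing (tr H) d); first by exists d.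
  by exists (- d); rewrite oppr_eq0 !rpairingNr Fd Gd oppr0 oppr_ge0.
have [|t t0 tP] := @dualP_step R n W (tr r) d Pr.
  by move=> e eW /tight_int /(FGr e eW)[->|->]; rewrite ?Fd ?Gd.
have [/VW Vt _] := tP t t0 (lexx t).
have [c Vc] := @seq_lower_bound R _ V (fun v => pairing (- d) (tr v - tr r)).
have FE : pairing (tr F) (tr r) = -1 by apply/tight_int.
have GE : pairing (tr G) (tr r) = -1 by apply/tight_int.
have Hr0 : 1 <= 1 + pairing (tr H) (tr r).
  by rewrite lerDl to_realE ler0z; lia.
(* The face [F = G = -1] lies above its value at [r] for this functional,
   although the direction [d] decreases it. *)
pose w := - (`|c| *: tr H + d).
have := @conv_face _ _ _ _ (tr F + tr G) (- (1 + 1)) (pairing w (tr r)) w Vt.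
have -> : (pairing w (tr r) <= pairing w (tr r + t *: d)) = false.
  rewrite rpairingDr rpairingZr lerDl pairingNl pairingDl pairingZl.
  by rewrite mulrN oppr_ge0 leNgt mulr_gt0 // ltr_wpDl ?pairing_gt0 ?mulr_ge0.
move=> K; suff : false by []; apply: K => [v vV||v vV].
- have /VW Pv := conv_mem R vV; rewrite pairingDl.
  by have := Pv F FW; have := Pv G GW; lra.
- by rewrite pairingDl !rpairingDr !rpairingZr Fd Gd FE GE; lra.
have /VW Pv := conv_mem R vV; rewrite pairingDl => FGv.
have Fv : pairing F v = -1.
  by apply/(tight_int R); have := Pv F FW; have := Pv G GW; lra.
have Gv : pairing G v = -1.
  by apply/(tight_int R); have := Pv F FW; have := Pv G GW; lra.
case: (eqVneq v r) => [-> //|vr].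
have Hv : pairing (tr H) (tr v) = -1.
  apply/tight_int; have := (dualP_int R W v).1 Pv H HW => Hv0.
  case: (eqVneq (pairing H v) (-1)) => // Hv1; case: no; exists v.
  by split=> //; lia.
(* From [r] to [v], the [H] part of [w] gains [|c|] times the integer [1 + H(r) >= 1], which absorbs
   the change of at least [c] from [- d]. *)
have := Vc v vV; rewrite !pairingNl !pairingDl !pairingZl Hv rpairingDr rpairingNr.
have := ler_norm (- c); rewrite normrN => c1 c2.
have : `|c| <= `|c| * (1 + pairing (tr H) (tr r)) by rewrite ler_peMr.
lra.
Qed.

End Reflexive.


(** * Faces of prescribed dimension *)

Lemma seq_argmin (R : realType) (T : eqType) (a : T) (s : seq T) (q : T -> R) :
  exists2 e, e \in a :: s & forall e', e' \in a :: s -> q e <= q e'.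
Proof.
elim: s a => [|b s IH] a.
  by exists a; rewrite ?mem_head // => e; rewrite inE => /eqP->.
have [e es emin] := IH b; have [ae|/ltW ea] := leP (q a) (q e).
  exists a => [|e']; rewrite ?mem_head // inE => /predU1P[-> //|/emin].
  exact: le_trans.
exists e => [|e']; rewrite inE ?es ?orbT // => /predU1P[->//|]; exact: emin.
Qed.

(** [g e0] spans an extreme ray, exposed by [d], of the cone of forms restricted to [U]. Unless all
    forms are proportional there, some ratio [q] is minimal on a proper subset, and the witness for
    that subset, scaled down, is added to [c']. *)
Lemma extremal_form (R : realType) n (T : eqType) (s : seq T)
    (g : T -> 'rV[R]_n) (U : 'rV[R]_n -> Prop) p e :
  (forall a u v, U u -> U v -> U (a *: u + v)) -> U p -> e \in s ->
  (forall e, e \in s -> 0 < pairing (g e) p) ->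
  exists d e0, [/\ U d, e0 \in s, pairing (g e0) d = 0,
    forall e, e \in s -> 0 <= pairing (g e) d &
    forall e, e \in s -> pairing (g e) d = 0 -> forall c, U c ->
      pairing (g e) c * pairing (g e0) p = pairing (g e0) c * pairing (g e) p].
Proof.
move=> UZ Up; have [k] := ubnP (size s).
elim: k s e => // k IH [//|e0 s] e' sk _ sp.
have [par|npar] := classic (forall e, e \in e0 :: s -> forall c, U c ->
    pairing (g e) c * pairing (g e0) p = pairing (g e0) c * pairing (g e) p).
  exists 0, e0; rewrite mem_head rpairing0r; split=> //.
  - by have := UZ (-1) p p Up Up; rewrite scaleN1r addNr.
  - by move=> e _; rewrite rpairing0r.
  - by move=> e es _; exact: par.
have [e1 [e1s [c [Uc e1c]]]] : exists e1, e1 \in e0 :: s /\ exists c, U c /\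
    pairing (g e1) c * pairing (g e0) p <> pairing (g e0) c * pairing (g e1) p.
  apply: NNPP => no; apply: npar => e es c Uc; apply: NNPP => ne.
  by apply: no; exists e; split=> //; exists c.
pose q e := pairing (g e) c / pairing (g e) p.
have [e2 e2s e2min] := seq_argmin e0 s q.
(* Subtracting the minimal ratio makes the minimizers vanish at [c'] and leaves the other forms
   positive. *)
pose c' := - q e2 *: p + c.
have Uc' : U c' by exact: UZ.
have c'E e : e \in e0 :: s ->
    pairing (g e) c' = (q e - q e2) * pairing (g e) p.
  move=> es; rewrite rpairingDr rpairingZr mulrBl divfK ?gt_eqF ?sp //.
  by rewrite mulNr addrC.
have c'0 e : e \in e0 :: s -> (pairing (g e) c' == 0) = (q e == q e2).
  move=> es; rewrite c'E // mulf_eq0 subr_eq0.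
  by rewrite [pairing _ p == 0]gt_eqF ?orbF ?sp.
pose s' := [seq e <- e0 :: s | pairing (g e) c' == 0].
have s's e : e \in s' -> e \in e0 :: s by rewrite mem_filter => /andP[].
have [|||d' [e3 [Ud' e3s' e3d' d'ge0 d'0]]] := IH s' e2.
- rewrite size_filter; apply: (@leq_trans (size (e0 :: s))) => //.
  rewrite -(count_predC (fun e => pairing (g e) c' == 0)) -addn1 leq_add2l.
  rewrite -has_count; apply: contra_notT e1c => /hasPn all0.
  have := all0 _ e1s; have := all0 _ (mem_head e0 s).
  rewrite /= !negbK !c'0 ?mem_head // => /eqP <-.
  by rewrite /q eq_sym eqr_div ?lt0r_neq0 ?sp ?mem_head // => /eqP.
- by rewrite mem_filter c'0 // eqxx.
- by move=> e /s's /sp.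
pose Q e t :=
  pairing (g e) c' = 0 \/ 0 < pairing (g e) c' + t * pairing (g e) d'.
have [e es|t t0 tQ] := @small_uniform R _ (e0 :: s) Q.
  have [c0|c0] := eqVneq (pairing (g e) c') 0; first by exists 1 => // *; left.
  have cpos : 0 < pairing (g e) c'.
    by rewrite lt_def c0 c'E // mulr_ge0 ?subr_ge0 ?e2min // ltW // sp.
  have [t t0 tc] := small_slope (pairing (g e) d') cpos.
  by exists t => // *; right; exact: tc.
have in_s' e : e \in e0 :: s -> pairing (g e) c' = 0 -> e \in s'.
  by move=> es /eqP; rewrite mem_filter es andbT.
exists (t *: d' + c'), e3; split=> [||||e es].
- exact: UZ.
- exact: s's.
- rewrite rpairingDr rpairingZr e3d' mulr0 add0r.
  by move: e3s'; rewrite mem_filter => /andP[/eqP].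
- move=> e es; rewrite rpairingDr rpairingZr.
  have [c0|] := tQ e t es t0 (lexx t); last by rewrite addrC => /ltW.
  by rewrite c0 addr0 mulr_ge0 ?d'ge0 ?in_s' // ltW.
rewrite rpairingDr rpairingZr.
have [c0|] := tQ e t es t0 (lexx t); last by rewrite addrC => /gt_eqF/eqP.
rewrite c0 addr0 => /eqP; rewrite mulf_eq0 gt_eqF //= => /eqP ed'.
by apply: d'0 => //; exact: in_s'.
Qed.

Lemma affdim_unique (R : realType) n (F : 'rV[R]_n -> Prop) k k' :
  affdim F k -> affdim F k' -> k = k'.
Proof.
move=> [[m [X [x [Fx FX <-]]]] le_k] [[m' [X' [x' [Fx' FX' <-]]]] le_k'].
by apply/eqP; rewrite eqn_leq le_k' // le_k.
Qed.

Section Faces.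
Variables (R : realType) (n : nat) (W : seq 'rV[int]_n).
Local Notation tr := (@to_real R n).
Local Notation P := (@dualP R n W).

(** [y] is relatively interior: forms tight there vanish on the kernel of [A^T], so short steps in
    all kernel directions stay in [F]. *)
Lemma face_affdim k (A : 'M[R]_(k, n)) (F : 'rV[R]_n -> Prop) u c y :
  row_free A -> (forall x, F x <-> P x /\ pairing u x = c) -> F y ->
  (forall z z', F z -> F z' -> (z - z') *m A^T = 0) ->
  (forall d, d *m A^T = 0 -> pairing u d = 0) ->
  (forall e, e \in W -> pairing (tr e) y = -1 ->
     forall d, d *m A^T = 0 -> pairing (tr e) d = 0) ->
  affdim F (n - k)%N.
Proof.
move=> Afree FE Fy Fker uker eker; pose N := kermx A^T.
have rN : \rank N = (n - k)%N by rewrite mxrank_ker mxrank_tr (eqP Afree).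
have Nker i : row i N *m A^T = 0 by apply/sub_kermxP; exact: row_sub.
have [Py uy] := (FE y).1 Fy.
split.
  pose Q i t := P (y + t *: row i N).
  have [i _|t t0 tQ] := @small_uniform R _ (enum 'I_n) Q.
    have [|t t0 tP] := @dualP_step R n W y (row i N) Py.
      by move=> e eW ey; rewrite (eker e).
    by exists t => // t' t'0 t't; have [] := tP t' t'0 t't.
  pose X := \matrix_i (y + t *: row i N).
  exists n, X, y; split=> // [i|].
    rewrite rowK; apply/FE; split; first by apply: tQ; rewrite ?mem_enum.
    by rewrite rpairingDr rpairingZr (uker _ (Nker i)) mulr0 addr0.
  suff -> : diff_mx X y = t *: N by rewrite mxrank_scale_nz ?gt_eqF.
  by apply/matrixP => i j; rewrite !mxE addrAC subrr add0r.
move=> m X x Fx FX; rewrite -rN; apply/mxrankS/row_subP => i.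
apply/sub_kermxP; have -> : row i (diff_mx X x) = row i X - x.
  by apply/rowP => j; rewrite !mxE.
exact: Fker.
Qed.

Variable V : seq 'rV[int]_n.
Hypothesis VW : forall x, @conv R n V x <-> P x.

(** [e] need not define a facet, as [W] may contain more than the vertices of the dual; an extreme
    form among those tight at [x] does. *)
Lemma tight_skeleton (x : 'rV[int]_n) e : P (tr x) -> e \in W ->
  pairing e x = -1 -> skeleton (@conv R n V) (n - 1) (tr x).
Proof.
move=> Px eW /(tight_int R) ex.
pose s := [seq e <- W | pairing (tr e) (tr x) == -1].
have ss e' : e' \in s -> pairing (tr e') (tr x) = -1.
  by rewrite mem_filter => /andP[/eqP].
have [||||d [e0 [_ e0s e0d dge0 d0]]] :=
  @extremal_form R n _ s tr (fun=> True) (- tr x) e => //.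
- by rewrite mem_filter ex eqxx.
- by move=> e' /ss; rewrite rpairingNr => ->; rewrite opprK.
have e0W : e0 \in W by move: e0s; rewrite mem_filter => /andP[].
have [|t t0 tP] := @dualP_step R n W (tr x) d Px.
  by move=> e' e'W e'x; apply: dge0; rewrite mem_filter e'x eqxx.
have [Py ytight] := tP t t0 (lexx t).
pose F z := conv V z /\ pairing (tr e0) z = -1.
have FE z : F z <-> P z /\ pairing (tr e0) z = -1.
  by split=> -[/VW].
have Fx : F (tr x) by split; [exact/VW | exact: ss].
exists F; split=> //; first by exists (tr e0), (-1); split=> // z /VW; apply.
apply: (@face_affdim 1 (tr e0) F (tr e0) (-1) (tr x + t *: d)).
- rewrite /row_free rank_rV; case: (eqVneq (tr e0) 0) => // z.
  have := ss _ e0s; rewrite z pairing0l => /eqP.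
  by rewrite eq_sym oppr_eq0 oner_eq0.
- exact: FE.
- apply/FE; split=> //.
  by rewrite rpairingDr rpairingZr e0d mulr0 addr0; exact: ss.
- move=> z z' [_ z0] [_ z'0]; apply/eqP.
  by rewrite mulmx_tr_pairing rpairingDr rpairingNr z0 z'0 subrr.
- by move=> z /eqP; rewrite mulmx_tr_pairing => /eqP.
move=> e' e'W /(ytight e' e'W)[e'x e'd] z /eqP.
rewrite mulmx_tr_pairing => /eqP z0.
have := d0 e' _ e'd z I; rewrite !rpairingNr z0 (ss _ e0s) e'x opprK mulr1 mul0r.
by apply; rewrite mem_filter e'x eqxx.
Qed.

(** Two rounds: [e0] is extreme among the forms tight at [x], then [e1] among the others restricted
    to the kernel of [e0]; together they span a two-dimensional face of the cone of tight forms. *)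
Lemma two_tight_skeleton (x : 'rV[int]_n) : P (tr x) -> two_tight W x ->
  skeleton (@conv R n V) (n - 2) (tr x).
Proof.
move=> Px [e [e' [eW e'W ee' ex e'x]]].
pose s := [seq e <- W | pairing (tr e) (tr x) == -1].
have sP f : (f \in s) = (pairing (tr f) (tr x) == -1) && (f \in W).
  by rewrite mem_filter.
have ss f : f \in s -> pairing (tr f) (tr x) = -1 by rewrite sP => /andP[/eqP].
have es : e \in s by rewrite sP eW andbT; apply/eqP/tight_int.
have e's : e' \in s by rewrite sP e'W andbT; apply/eqP/tight_int.
have [||d1 [e0 [_ e0s e0d1 d1ge0 d10]]] :=
  @extremal_form R n _ s tr (fun=> True) (- tr x) e _ I es.
- by [].
- by move=> f /ss; rewrite rpairingNr => ->; rewrite opprK.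
have d1e0 f : f \in s -> pairing (tr f) d1 = 0 -> f = e0.
  move=> fs fd1; apply: (@to_real_inj R); apply/eqP; rewrite -subr_eq0.
  rewrite -pairing_eq0 pairingDl pairingNl.
  have := d10 f fs fd1 (tr f - tr e0) I.
  by rewrite !rpairingNr !ss // opprK !mulr1 => ->; rewrite subrr.
pose s2 := [seq f <- s | f != e0].
have s2s f : f \in s2 -> f \in s by rewrite mem_filter => /andP[].
have [f fs2] : exists f, f \in s2.
  case: (eqVneq e e0) => [E|E].
    by exists e'; rewrite mem_filter e's andbT -E eq_sym.
  by exists e; rewrite mem_filter es E.
have [||d2 [e1 [e0d2 e1s2 e1d2 d2ge0 d20]]] :=
  @extremal_form R n _ s2 tr (fun c => pairing (tr e0) c = 0) d1 f _ e0d1 fs2.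
- by move=> a u v u0 v0; rewrite rpairingDr rpairingZr u0 v0 mulr0 addr0.
- move=> g; rewrite mem_filter => /andP[ge0 gs].
  by rewrite lt_def d1ge0 // andbT; apply: contraNneq ge0 => /(d1e0 g gs) ->.
have e1s := s2s _ e1s2.
have e1d1 : 0 < pairing (tr e1) d1.
  rewrite lt_def d1ge0 // andbT; move: e1s2; rewrite mem_filter => /andP[+ _].
  by apply: contraNneq => /(d1e0 _ e1s) ->.
have inW g : g \in s -> g \in W by rewrite sP => /andP[].
have [|t t0 tP] := @dualP_step R n W (tr x) d2 Px.
  move=> g gW gx; case: (eqVneq g e0) => [->|ge0]; first by rewrite e0d2.
  by apply: d2ge0; rewrite mem_filter ge0 sP gx eqxx.
have [Py ytight] := tP t t0 (lexx t).
pose A := col_mx (tr e0) (tr e1).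
have AE z : z *m A^T = 0 <-> pairing (tr e0) z = 0 /\ pairing (tr e1) z = 0.
  rewrite tr_col_mx mul_mx_row -row_mx0; split=> [/eq_row_mx[/eqP + /eqP]|[]].
    by rewrite !mulmx_tr_pairing => /eqP-> /eqP->.
  move=> /eqP; rewrite -mulmx_tr_pairing => /eqP->.
  by move=> /eqP; rewrite -mulmx_tr_pairing => /eqP->.
have Afree : row_free A.
  (* [b0, b1] is a dual basis to [tr e0, tr e1]. *)
  pose b1 := (pairing (tr e1) d1)^-1 *: d1; pose b0 := - tr x - b1.
  have mulE (u v : 'rV[R]_n) : u *m v^T = (pairing u v)%:M.
    apply/matrixP => i j; rewrite !ord1 !mxE eqxx mulr1n.
    by apply: eq_bigr => k _; rewrite mxE.
  apply/row_freeP; exists (row_mx b0^T b1^T).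
  rewrite mul_col_row !mulE (@scalar_mx_block _ 1 1).
  have e0b1 : pairing (tr e0) b1 = 0 by rewrite rpairingZr e0d1 mulr0.
  have e1b1 : pairing (tr e1) b1 = 1 by rewrite rpairingZr mulVf ?gt_eqF.
  rewrite !rpairingDr !rpairingNr e0b1 e1b1 !ss // opprK subr0 subrr.
  by rewrite !raddf0.
pose F z := conv V z /\ pairing (tr e0 + tr e1) z = - (1 + 1).
have FE z : F z <-> P z /\ pairing (tr e0 + tr e1) z = - (1 + 1).
  by split=> -[/VW].
have F01 z : F z -> pairing (tr e0) z = -1 /\ pairing (tr e1) z = -1.
  move=> /FE[Pz]; rewrite pairingDl => z01.
  by have := Pz _ (inW _ e0s); have := Pz _ (inW _ e1s); split; lra.
have Fx : F (tr x) by apply/FE; split=> //; rewrite pairingDl !ss // opprD.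
exists F; split=> //.
  exists (tr e0 + tr e1), (- (1 + 1)); split=> // z /VW Pz.
  rewrite pairingDl; have := Pz _ (inW _ e0s); have := Pz _ (inW _ e1s); lra.
apply: (@face_affdim 2 A F _ _ (tr x + t *: d2) Afree FE).
- apply/FE; split=> //; rewrite pairingDl !rpairingDr !rpairingZr e0d2 e1d2.
  by rewrite !ss // mulr0 !addr0 opprD.
- move=> z z' /F01[z0 z1] /F01[z0' z1']; apply/AE.
  by rewrite !rpairingDr !rpairingNr z0 z1 z0' z1' !subrr.
- by move=> z /AE[z0 z1]; rewrite pairingDl z0 z1 addr0.
move=> g gW /(ytight g gW)[gx gd] z /AE[z0 z1].
case: (eqVneq g e0) => [->//|ge0].
have gs2 : g \in s2 by rewrite mem_filter ge0 sP gx eqxx.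
have := d20 g gs2 gd z z0; rewrite z1 mul0r => /eqP; rewrite mulf_eq0.
by rewrite (negPf (lt0r_neq0 e1d1)) orbF => /eqP.
Qed.

(** A supporting hyperplane through the origin, an interior point, has normal 0, and its face is the
    whole [n]-dimensional polytope. *)
Lemma skeleton_proper k (x : 'rV[int]_n) : (k < n)%N ->
  skeleton (@conv R n V) k (tr x) -> P (tr x) /\ x != 0.
Proof.
move=> kn [F [[u [c [uc FE]]] Fk Fx]].
have [Vx ux] := (FE _).1 Fx; split; first exact/VW.
apply: contraL kn => /eqP x0; rewrite -leqNgt.
have c0 : c = 0 by rewrite -ux x0 to_real0 rpairing0r.
have u0 : u = 0.
  apply/eqP; rewrite -pairing_eq0 eq_le pairing_ge0 andbT.
  have [t t0 /VW/uc] := @dualP_ray R n W (- u).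
  by rewrite c0 rpairingZr rpairingNr mulrN oppr_ge0 pmulr_rle0.
have Fn : affdim F (n - 0)%N.
  apply: (@face_affdim 0 0 F u c (tr x)) => //.
  - by rewrite /row_free mxrank0.
  - by move=> z; rewrite FE VW.
  - by move=> z z' _ _; rewrite trmx0 mulmx0.
  - by move=> d _; rewrite u0 pairing0l.
  - by move=> e _; rewrite x0 to_real0 rpairing0r => /eqP;
      rewrite eq_sym oppr_eq0 oner_eq0.
by rewrite (affdim_unique Fk Fn) subn0.
Qed.

End Faces.

(** * Sublattices generated by a set *)

Section LatticeGen.
Variables (n : nat) (S : 'rV[int]_n -> Prop).

Lemma lattice_gen_mem v : S v -> lattice_gen S v.
Proof.
move=> Sv; exists [:: v]; split=> [w|]; first by rewrite inE => /eqP->.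
by exists (fun=> 1); rewrite big_ord1 scale1r.
Qed.

Lemma lattice_gen0 : lattice_gen S 0.
Proof. by exists [::]; split=> //; exists (fun=> 1); rewrite big_ord0. Qed.

Lemma lattice_genZD k v w :
  lattice_gen S v -> lattice_gen S w -> lattice_gen S (k *: v + w).
Proof.
move=> [s [sS [c ->]]] [t [tS [b ->]]]; exists (s ++ t); split=> [z|].
  by rewrite mem_cat => /orP[/sS|/tS].
rewrite size_cat.
exists (fun i => match split i with inl i => k * c i | inr i => b i end).
rewrite big_split_ord scaler_sumr; congr (_ + _); apply: eq_bigr => i _.
  rewrite (unsplitK (inl i : 'I_(size s) + 'I_(size t))) scalerA.
  by rewrite nth_cat /= ltn_ord.
rewrite (unsplitK (inr i : 'I_(size s) + 'I_(size t))).
by rewrite nth_cat /= ltnNge leq_addr addKn.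
Qed.

Lemma lattice_gen_sub (L : 'rV[int]_n -> Prop) : L 0 ->
  (forall k v w, L v -> L w -> L (k *: v + w)) ->
  (forall v, S v -> L v) -> forall v, lattice_gen S v -> L v.
Proof.
move=> L0 LZD SL v [s [sS [c ->]]].
elim/big_rec: _ => // i w _; apply: LZD; apply/SL/sS/mem_nth/ltn_ord.
Qed.

End LatticeGen.

Theorem theorem1 (R : realType) (n : nat) (V : seq 'rV[int]_n) :
  (3 <= n)%N -> @reflexive_polytope R n V ->
  forall v : 'rV[int]_n,
    Lambda (@conv R n V) (n - 2)%N v <-> Lambda (@conv R n V) (n - 1)%N v.
Proof.
move=> n3 [VO [W dualW]] v; have VW := bipolar VO dualW.
have n0 : (0 < n)%N by apply: leq_trans n3.
pose L := Lambda (@conv R n V) (n - 2)%N.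
have L0 : L 0 by exact: lattice_gen0.
have LZD k u w : L u -> L w -> L (k *: u + w) by exact: lattice_genZD.
have tight2 m : dualP W (@to_real R n m) -> two_tight W m -> L m.
  by move=> Pm m2; apply: lattice_gen_mem; exact: two_tight_skeleton m2.
(* Stronger than the claim on the boundary: all lattice points of the polytope lie in [L]. *)
have PL m : dualP W (@to_real R n m) -> L m.
  have [V' [V'L PV']] := conv_two_tight VW n3.
  move=> /dualP_int; apply: (@inP_L _ n (@pairing int n) W L).
  - exact: pairingDr.
  - exact: pairingZr.
  - exact: L0.
  - by move=> u w /(LZD 1)/[apply]; rewrite scale1r.
  - by move=> u /(LZD (-1))/(_ L0); rewrite scaleN1r addr0.
  - by move=> u /(dualP_int R) Pu; apply: dualP_tight_exists.
  - move=> u F G /(dualP_int R) Pu FW GW FG Fu Gu.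
    by apply: tight2 => //; exists F, G.
  - move=> F G r FW GW Fr Gr.
    have [u uV' FGu] := positive_vertex PV' Fr Gr.
    have [Pu u2] := V'L u uV'.
    by exists u; split=> //; [exact/dualP_int/Pu | exact: tight2].
  - move=> F G H r FW GW HW /(dualP_int R) Pr Fr Gr Hr FGr.
    have [r' [/dualP_int Pr' r'r Fr' Gr' Hr']] :=
      second_ridge_point VW n3 FW GW HW Pr Fr Gr Hr FGr.
    by exists r'.
split; apply: lattice_gen_sub => //.
- exact: lattice_gen0.
- by move=> k u w; exact: lattice_genZD.
- move=> u Su; apply: lattice_gen_mem.
  have [|Pu u0] := skeleton_proper VW _ Su; first by rewrite ltn_subrL n0.
  have [e eW eu] := dualP_tight_exists VW Pu u0.
  exact: (tight_skeleton VW Pu eW eu).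
- move=> u Su; apply: PL.
  by have [|] := skeleton_proper VW _ Su; first by rewrite ltn_subrL n0.
Qed.
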